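(* Let $\epsilon\in(0,1)$. Any streaming algorithm in the insertion-only model that outputs $\tilde{H}$ with $|\tilde{H} - H| < \epsilon$ with probability at least $2/3$, where $H$ is the empirical entropy of the stream vector, requires $\Omega(\epsilon^{-2})$ bits of space.
   Context: Insertion-only streaming model: a vector $\mathcal{X} \in \mathbb{Z}^n$ starts at $0$ and receives updates $(i_t,\Delta_t)$ with $\Delta_t \ge 0$, causing $\mathcal{X}_{i_t} \leftarrow \mathcal{X}_{i_t}+\Delta_t$. The empirical entropy of the final vector is $H = -\sum_{i=1}^n \frac{|\mathcal{X}_i|}{F_1}\log\frac{|\mathcal{X}_i|}{F_1}$ with $F_1=\|\mathcal{X}\|_1$. Space is measured between updates. *)

(* Defs.v *)
From HB Require Import structures.
From mathcomp Require Import all_boot all_order all_algebra.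
From mathcomp Require Import all_classical all_reals all_analysis.

Set Implicit Arguments.
Unset Strict Implicit.
Unset Printing Implicit Defensive.

Import Order.TTheory GRing.Theory Num.Theory.
Import numFieldNormedType.Exports.

Local Open Scope classical_set_scope.
Local Open Scope ring_scope.

Definition update (n : nat) : Type := ('I_n * int)%type.

Definition apply_update (n : nat) (X : 'rV[int]_n) (u : update n) : 'rV[int]_n :=
  X + u.2 *: delta_mx 0 u.1.

Definition stream_vector (n : nat) (st : seq (update n)) : 'rV[int]_n :=
  foldl (@apply_update n) 0 st.

(* Insertion-only streams of length at most m with increments at most M.
   The a priori bounds m and M are the usual parameters of the model: finite
   memory is to be expected only from algorithms that handle bounded streams. *)
Definition insertion_only (n m M : nat) (st : seq (update n)) : bool :=
  (size st <= m)%N && all (fun u : update n => 0 <= u.2 <= M%:Z) st.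

Definition F1 (R : realType) (n : nat) (X : 'rV[int]_n) : R :=
  \sum_(i < n) (`|X ord0 i|)%:~R.

Definition log2 (R : realType) (x : R) : R := ln x / ln 2.

(* As usual 0 log 0 = 0, whatever the junk value of ln 0. *)
Definition entropy (R : realType) (n : nat) (X : 'rV[int]_n) : R :=
  - \sum_(i < n)
      let p := (`|X ord0 i|)%:~R / F1 R X in p * log2 p.

Definition memory (s : nat) : Type := s.-tuple bool.

(* Memory after processing st, the first element of st arriving at time t. *)
Fixpoint run (n s : nat) (step : nat -> memory s -> update n -> memory s)
    (t : nat) (x : memory s) (st : seq (update n)) : memory s :=
  if st is u :: st' then run step t.+1 (step t x u) st' else x.

(* A (non-uniform) randomized streaming algorithm over [n] whose memory between
   updates consists of s bits.  Only these bits are charged: computation during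
   an update is arbitrary, and the random seed and the clock are free.  As the
   seed is an arbitrary probability space and the transition depends on the
   time, this covers both coins tossed afresh at every update and randomness
   that can be reread at will. *)
Record streaming_algorithm (R : realType) (n s : nat) := StreamingAlgorithm {
  seed_display : measure_display ;
  seed : measurableType seed_display ;
  seed_law : probability seed R ;
  init : seed -> memory s ;
  step : seed -> nat -> memory s -> update n -> memory s ;
  report : seed -> nat -> memory s -> R ;
  measurable_report : forall st : seq (update n),
    measurable_fun [set: seed]
      (fun w => report w (size st) (run (step w) 0 (init w) st))
}.

Definition output (R : realType) (n s : nat) (A : streaming_algorithm R n s)
    (st : seq (update n)) (w : seed A) : R :=
  report w (size st) (run (step w) 0 (init w) st).

Arguments output {R n s} A st w.

(* The entropy is undefined for the zero vector, so nothing is required there. *)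
Definition estimates_entropy (R : realType) (n s : nat)
    (A : streaming_algorithm R n s) (m M : nat) (eps : R) : Prop :=
  forall st : seq (update n),
    insertion_only m M st -> stream_vector st != 0 ->
    let good := [set w | `|output A st w - entropy R (stream_vector st)| < eps] in
    ((2 / 3 : R)%:E <= seed_law A good)%E.

(* Main.v *)
Require Import Defs.
From HB Require Import structures.
From mathcomp Require Import all_boot all_order all_algebra.
From mathcomp Require Import all_classical all_reals all_analysis.
From mathcomp Require Import measurable_realfun.
From mathcomp Require Import zify ring lra.
Import Order.TTheory GRing.Theory Num.Theory.
Import numFieldNormedType.Exports.
Local Open Scope ring_scope.

(** Alice holds x, Bob holds y, two subsets of a set T of size 8L.  Feeding the
    items (i, [i \in x]) and then (i, [i \in y]) to the algorithm yields a vector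
    whose entropy is log N + |x (+) y| / N with N = |T|, so a good estimate
    determines the Hamming distance of x and y up to 2 eps N, of order sqrt N.
    Fix a seed that is good for 2/3 of the pairs (x, y).  For a given memory
    state reached after x, two sets x and x' in the same class which are both good
    for y are at almost the same distance from y.  When x and x' are far apart this
    happens for few y only (anticoncentration of the central binomial
    coefficient), and Hamming balls of radius N/4 are exponentially small; hence by
    Cauchy-Schwarz over each class there are exponentially many classes. *)

(** * Binomial bounds and counting in the Hamming cube *)

Section Combinatorics.
Local Open Scope nat_scope.

(** The factor 2k+1 makes the induction close: from k to k+1 the left side is multiplied by
    4(2k+1)(2k+3)/(k+1)^2, which is at most 16 because (2k+1)(2k+3) <= (2k+2)^2. *)
Lemma bin_half_sqr_le k : 'C(k.*2, k) ^ 2 * k.*2.+1 <= 16 ^ k.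
Proof.
elim: k => [|k IH]; first by rewrite bin0.
have E : k.+1 * 'C(k.+1.*2, k.+1) = 2 * k.*2.+1 * 'C(k.*2, k).
  have sym : 'C(k.*2.+1, k) = 'C(k.*2.+1, k.+1).
    by rewrite -bin_sub; [congr 'C(_, _); lia | lia].
  by rewrite doubleS binS sym; have /= := mul_bin_diag k.*2.+1 k; lia.
rewrite (expnS 16).
have : k.+1 ^ 2 * ('C(k.+1.*2, k.+1) ^ 2 * (k.+1.*2).+1)
     = 4 * k.*2.+1 * (k.*2.+1 * (k.+1.*2).+1) * 'C(k.*2, k) ^ 2.
  rewrite mulnA -expnMn E !expnMn; lia.
move: IH; set a := 'C(k.*2, k) ^ 2; set b := 'C(_, _) ^ 2 * _.
set c := 16 ^ k => IH Eb.
have h : k.*2.+1 * (k.+1.*2).+1 <= 4 * k.+1 ^ 2 by rewrite -!muln2; nia.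
rewrite -(@leq_pmul2l (k.+1 ^ 2)) ?expn_gt0// Eb.
apply: (@leq_trans (4 * k.*2.+1 * (4 * k.+1 ^ 2) * a)).
  by rewrite leq_mul2r leq_mul2l h !orbT.
move: (k.+1 ^ 2) (k.*2.+1) IH => e f IH.
have -> : 4 * f * (4 * e) * a = e * (16 * (a * f)) by ring.
by rewrite !leq_mul2l IH !orbT.
Qed.

Lemma bin_le_half d j : 'C(d, j) <= 'C(d, d./2).
Proof.
have low i k : (i + k).*2 <= d -> 'C(d, i) <= 'C(d, i + k).
  elim: k => [|k IH] hk; first by rewrite addn0.
  apply: (leq_trans (IH _)); first by lia.
  rewrite addnS -(@leq_pmul2l (i + k).+1) // mul_bin_left leq_mul2r.
  by apply/orP; right; lia.
have half i : i <= d./2 -> 'C(d, i) <= 'C(d, d./2).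
  by move=> hi; have := low i (d./2 - i); rewrite subnKC //; apply; lia.
have [/half //|hj] := leqP j d./2.
have [hjd|/bin_small -> //] := leqP j d.
by rewrite -bin_sub //; apply: half; lia.
Qed.

Lemma bin_sqr_le d j : 'C(d, j) ^ 2 * d.+1 <= 4 ^ d.
Proof.
apply: (@leq_trans ('C(d, d./2) ^ 2 * d.+1)).
  by rewrite leq_mul2r leq_exp2r // bin_le_half orbT.
have := odd_double_half d; set k := d./2.
case: (odd d) => /= <-.
  2: by have := bin_half_sqr_le k; rewrite -[in 4 ^ _]mul2n expnM.
(* Odd d = 2k+1: the coefficient is half the central one for 2k+2, so the even bound at k+1
   applies. *)
rewrite add1n.
have := bin_half_sqr_le k.+1; rewrite doubleS binS.
have <- : 'C(k.*2.+1, k) = 'C(k.*2.+1, k.+1).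
  by rewrite -bin_sub; [congr 'C(_, _); lia | lia].
rewrite addnn -mul2n expnMn (expnS 16) (expnS 4) -[in 4 ^ _]mul2n expnM.
rewrite (_ : 4 ^ 2 = 16) //; move: ('C(_, _) ^ 2) (16 ^ k) => a b; nia.
Qed.

(** Second moment method on each class S of [c]. With g(y) the number of x in S good for y, AM-GM
    gives 2|S|g(y) <= g(y)^2 + |S|^2, and the collision hypotheses control the sum of g(y)^2.
    Dividing by |S| and summing over the classes gives the claim. *)
Lemma collision_bound (X Y K : finType) (c : X -> K) (G : X -> pred Y)
    (near : rel X) (B P : nat) :
  (forall x, \sum_x' near x x' <= B) ->
  (forall x x', c x = c x' -> ~~ near x x' -> \sum_y (G x y && G x' y) <= P) ->
  2 * \sum_x \sum_y G x y <= #|X| * #|Y| + #|X| * P + #|K| * (#|Y| * B).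
Proof.
move=> hB hP.
have class k : 2 * \sum_(x | c x == k) \sum_y G x y <=
    #|[pred x | c x == k]| * (#|Y| + P) + #|Y| * B.
  set S := [pred x | c x == k].
  case: (posnP #|S|) => [/card0_eq S0|Spos].
    by rewrite big_pred0 // => x; have := S0 x; rewrite inE.
  rewrite -(leq_pmul2l Spos).
  pose g y := \sum_(x | c x == k) G x y.
  have -> : \sum_(x | c x == k) \sum_y G x y = \sum_y g y by rewrite exchange_big.
  have amgm : #|S| * (2 * \sum_y g y) <= \sum_y (g y * g y + #|S| ^ 2).
    rewrite mulnA big_distrr /=; apply: leq_sum => y _.
    by have [] := nat_Cauchy #|S| (g y); rewrite -!mulnn; lia.
  (* The sum of squares counts triples (x, x', y) with both x and x' good for y: a near pair
     accounts for at most |Y| of them, a far pair for at most P. *)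
  have sq : \sum_y g y * g y <= #|S| * (#|S| * P + #|Y| * B).
    have -> : \sum_y g y * g y =
        \sum_(x | c x == k) \sum_(x' | c x' == k) \sum_y (G x y && G x' y).
      under eq_bigr do rewrite /g big_distrl.
      rewrite exchange_big; apply: eq_bigr => x _ /=.
      rewrite exchange_big /=; apply: eq_bigr => y _ /=.
      rewrite big_distrr /=; apply: eq_bigr => x' _ /=.
      by rewrite mulnb.
    rewrite -sum_nat_const; apply: leq_sum => x /eqP cx.
    apply: (@leq_trans (\sum_(x' | c x' == k) (P + #|Y| * near x x'))).
      apply: leq_sum => x' /eqP cx'.
      have [_|far] := boolP (near x x').
        rewrite muln1 (leq_trans _ (leq_addl _ _)) // -sum1_card.
        by apply: leq_sum => y _; case: (_ && _).
      by rewrite muln0 addn0; apply: hP; rewrite ?cx.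
    rewrite big_split /= sum_nat_const leq_add2l -big_distrr /= leq_mul2l.
    apply/orP; right; apply: leq_trans (hB x).
    by rewrite [leqRHS](bigID [pred x' | c x' == k]) /= leq_addr.
  apply: (leq_trans amgm); rewrite big_split /= sum_nat_const.
  by rewrite [#|predT|]cardT -cardT; nia.
rewrite (partition_big c predT) //= big_distrr /=.
apply: (leq_trans (leq_sum _ (fun k _ => class k))).
rewrite big_split /= -big_distrl /= sum_nat_const.
suff -> : \sum_k #|[pred x | c x == k]| = #|X| by rewrite mulnDr.
rewrite -[RHS]sum1_card (partition_big c predT) //=.
by apply: eq_bigr => k _; rewrite sum1_card.
Qed.

Lemma sum_bool_card (T : finType) (P : pred T) : \sum_z (P z : nat) = #|P|.
Proof.
rewrite -sum1_card [RHS]big_mkcond; apply: eq_bigr => z _.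
by rewrite unfold_in; case: (P z).
Qed.

Definition symdiff {T : finType} (x y : {set T}) : {set T} :=
  [set i | (i \in x) (+) (i \in y)]%SET.

Lemma sum_symdiff {T : finType} (x : {set T}) (f : {set T} -> nat) :
  \sum_y f (symdiff x y) = \sum_z f z.
Proof.
rewrite [RHS](reindex_inj (h := symdiff x)) // => y y' e.
by apply/setP => i; have /setP/(_ i) := e; rewrite !inE => /addbI.
Qed.

(* Markov's inequality for the weight 2 ^ (N - |z|), whose total is 3 ^ N. *)
Lemma sum_small_sets (T : finType) (L : nat) : #|T| = 8 * L ->
  \sum_(z : {set T}) (#|z| <= 2 * L) <= 2 ^ (7 * L).
Proof.
move=> cT.
have total : \sum_(z : {set T}) 2 ^ #|~: z|%SET = 3 ^ (8 * L).
  have -> : 3 ^ (8 * L) = \prod_(i : T) (1 + 2) by rewrite prod_nat_const cT.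
  rewrite bigA_distr; apply: eq_big => z; first by rewrite inE.
  move=> _; rewrite -prod_nat_const big_mkcond; apply: eq_bigr => i _.
  by rewrite inE; case: (i \in z).
have : (\sum_(z : {set T}) (#|z| <= 2 * L)) * 2 ^ (6 * L) <= 3 ^ (8 * L).
  rewrite big_distrl -total; apply: leq_sum => z _ /=.
  case: (leqP #|z|) => //= hz; rewrite mul1n leq_exp2l //.
  by have := cardsC z; rewrite cT; lia.
move=> h; rewrite -(@leq_pmul2r (2 ^ (6 * L))) ?expn_gt0 //.
apply: (leq_trans h); rewrite -expnD -mulnDl !expnM.
(* 6561 <= 8192: this margin is what makes balls of radius a quarter of |T| exponentially small. *)
have h3 : 3 ^ 8 <= 2 ^ (7 + 6) by lia.
case: (posnP L) => [->|L0]; first by rewrite !expn0.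
by rewrite (leq_exp2r _ _ L0) h3.
Qed.

(** A set z splits freely into its traces on D and on the complement of D, and [bin_sqr_le] bounds
    each binomial coefficient by 2^|D| / sqrt(|D|+1). *)
Lemma sum_layer_le (T : finType) (D : {set T}) (q j : nat) :
  36 * q ^ 2 <= #|D| ->
  6 * q * \sum_(z : {set T}) (#|z :&: D|%SET == j) <= 2 ^ #|T|.
Proof.
move=> hq.
have layer : \sum_(z : {set T}) (#|z :&: D|%SET == j) <=
    'C(#|D|, j) * 2 ^ #|(~: D)%SET|.
  rewrite sum_bool_card -cards_draws -card_powerset -cardsX.
  pose f (z : {set T}) := ((z :&: D)%SET, (z :&: ~: D)%SET).
  rewrite -(@card_imset _ _ f) => [|z z' [e1 e2]]; last first.
    by rewrite -(finset.setID z D) -(finset.setID z' D) !finset.setDE e1 e2.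
  apply/subset_leq_card/fintype.subsetP => _ /imsetP [z hz ->].
  by rewrite !inE /= !finset.subsetIr andbT; exact: hz.
have binq : 6 * q * 'C(#|D|, j) <= 2 ^ #|D|.
  have e4 : (2 ^ #|D|) ^ 2 = 4 ^ #|D| by rewrite -expnM mulnC expnM.
  rewrite -leq_sqr e4 !expnMn.
  apply: leq_trans (bin_sqr_le #|D| j).
  by rewrite mulnC leq_mul2l (leq_trans hq) ?orbT.
apply: (@leq_trans (6 * q * ('C(#|D|, j) * 2 ^ #|(~: D)%SET|))).
  by rewrite leq_mul2l layer orbT.
by rewrite mulnA -(cardsC D) expnD leq_mul2r binq orbT.
Qed.

(* For z = x (+) y and D = x (+) x', the distances |x (+) y| and |x' (+) y| differ
   by 2 |z :&: D| - |D|. *)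
Lemma sum_balanced_le (T : finType) (D : {set T}) (q : nat) :
  36 * q ^ 2 <= #|D| ->
  6 * \sum_(z : {set T}) ((2 * #|z :&: D|%SET < #|D| + q) &&
                          (#|D| < 2 * #|z :&: D|%SET + q)) <= 2 ^ #|T|.
Proof.
move=> hq; case: (posnP q) => [->|q0].
  by rewrite big1 // => z _; rewrite !addn0; case: ltngtP.
have qD : q <= #|D| by nia.
(* The least v with 2v > |D| - q. The window for |z :&: D| then lies in the q values a, ..., a+q-1,
   and each layer has density at most 1/(6q). *)
pose a := ((#|D| - q)./2).+1.
rewrite -(leq_pmul2l q0) mulnA.
apply: (@leq_trans (q * 6 * \sum_(k < q) \sum_(z : {set T}) (#|z :&: D|%SET == a + k))).
  rewrite leq_mul2l exchange_big; apply/orP; right; apply: leq_sum => z _.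
  case: andP => // -[h1 h2].
  have hk : #|z :&: D|%SET - a < q by rewrite /a; lia.
  rewrite (bigD1 (Ordinal hk)) //= subnKC ?eqxx //; rewrite /a; lia.
rewrite big_distrr /= -[q in q * 2 ^ _]card_ord -sum_nat_const.
by apply: leq_sum => k _; rewrite [q * 6]mulnC; apply: sum_layer_le.
Qed.

Lemma hamming_collision (T K : finType) (c : {set T} -> K)
    (G : {set T} -> pred {set T}) (L q : nat) :
  #|T| = 8 * L -> 18 * q ^ 2 <= L ->
  (forall x x' y, c x = c x' -> G x y -> G x' y ->
     #|symdiff x y| < #|symdiff x' y| + q) ->
  2 * 2 ^ (8 * L) * 2 ^ (8 * L) <= 3 * \sum_x \sum_y G x y ->
  2 ^ L <= 6 * #|K|.
Proof.
move=> cT hq hG hgood.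
pose near (x x' : {set T}) := #|symdiff x x'| <= 2 * L.
set M := 2 ^ (8 * L) in hgood.
have cS : #|{set T}| = M by rewrite -cardsT -powersetT card_powerset cardsT cT.
have hB x : \sum_x' near x x' <= 2 ^ (7 * L).
  by rewrite (sum_symdiff x (fun z => #|z| <= 2 * L : nat)) sum_small_sets.
have hP x x' : c x = c x' -> ~~ near x x' -> \sum_y (G x y && G x' y) <= M %/ 6.
  rewrite /near -ltnNge => ec far; rewrite leq_divRL // mulnC.
  set D := symdiff x x' in far.
  (* Far means |D| > 2L, whence the hypothesis 18 q^2 <= L. *)
  have hD : 36 * q ^ 2 <= #|D| by lia.
  rewrite /M -cT; apply: leq_trans (sum_balanced_le T D q hD).
  rewrite leq_mul2l /= -[leqRHS](sum_symdiff x); apply: leq_sum => y _.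
  case: andP => // -[gx gx'].
  have := hG x x' y ec gx gx'; have := hG x' x y (esym ec) gx' gx.
  set z := symdiff x y.
  have ez := cardsID D z; have eD := cardsID z D.
  have -> : symdiff x' y = ((D :\: z) :|: (z :\: D))%SET.
    apply/setP => i; rewrite !inE.
    by case: (i \in x); case: (i \in x'); case: (i \in y).
  rewrite cardsU (_ : (_ :&: (_ :\: _))%SET = finset.set0) ?cards0; last first.
    by apply/setP => i; rewrite !inE; case: (i \in x); case: (i \in x'); case: (i \in y).
  rewrite [(D :&: z)%SET]finset.setIC in eD.
  by move=> h1 h2; rewrite lt0b; apply/andP; split; lia.
have := collision_bound _ _ _ c G near _ _ hB hP; rewrite cS.
have MB : M = 2 ^ L * 2 ^ (7 * L) by rewrite -expnD -mulSn.
have := leq_trunc_div M 6.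
have M0 : 0 < M by rewrite expn_gt0.
have B0 : 0 < 2 ^ (7 * L) by rewrite expn_gt0.
move: hgood MB M0 B0; set B := 2 ^ (7 * L); set S := \sum_x _.
move: (M %/ 6) => P hgood MB M0 B0 h6 hc.
(* Cancelling M leaves M <= 3P + 3|K|B. Since 6P <= M, half of M survives: M <= 6|K|B, where M = 2^L
   B. *)
have h1 : M * (4 * M) <= M * (3 * (M + P + #|K| * B)) by lia.
rewrite leq_pmul2l // in h1.
rewrite -(leq_pmul2r B0) -MB; lia.
Qed.

End Combinatorics.

(** * Averaging over the seed *)

(* If no seed were good enough, integrality would leave a gap of 1 in
   [3 * \sum_i E i w < 2 * #|I|], which survives integration over the seed. *)
Lemma exists_mostly_good (d : measure_display) (W : measurableType d)
    (R : realType) (P : probability W R) (I : finType) (E : I -> W -> bool) :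
  (forall i, measurable [set w | E i w]%classic) ->
  (forall i, ((2 / 3 : R)%:E <= P [set w | E i w]%classic)%E) ->
  exists w, (2 * #|I| <= 3 * \sum_i E i w)%N.
Proof.
move=> mE hE; apply: contrapT => /forallNP no.
have few w : (3 * \sum_i E i w < 2 * #|I|)%N.
  by rewrite ltnNge; apply/negP; exact: no.
pose A i := [set w | E i w]%classic.
have mI i : measurable_fun setT (EFin \o (\1_(A i) : W -> R)).
  by apply/measurable_EFinP; apply: measurable_indic; exact: mE.
have ge0 : forall (i : I) w, setT w -> (0 <= (\1_(A i) w : R)%:E)%E.
  by move=> i w _; rewrite lee_fin indicE.
have int : (\int[P]_w \sum_i (\1_(A i) w : R)%:E = \sum_i P (A i))%E.
  rewrite ge0_integral_sum //; apply: eq_bigr => i _.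
  by rewrite integral_indic ?classical_sets.setIT //; exact: mE.
have lo : ((2 / 3 * #|I|%:R : R)%:E <= \sum_i P (A i))%E.
  apply: (@le_trans _ _ (\sum_(i : I) (2 / 3 : R)%:E)%E); last first.
    by apply: lee_sum => i _; exact: hE.
  by rewrite sumEFin lee_fin big_const iter_addr_0 mulr_natr.
have up : (\sum_i P (A i) <= ((2 * #|I|%:R - 1) / 3 : R)%:E)%E.
  rewrite -int -[leRHS]mule1 -(@probability_setT _ _ _ P) -integral_cst //.
  apply: ge0_le_integral => //.
  - by move=> w _; apply: sume_ge0 => i _; apply: ge0.
  - exact: emeasurable_sum.
  - move=> w _; rewrite sumEFin lee_fin.
    have -> : \sum_i (\1_(A i) w : R) = (\sum_i E i w)%N%:R.
      rewrite natr_sum; apply: eq_bigr => i _.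
      by rewrite indicE /A; congr (nat_of_bool _)%:R; apply/idP/idP; rewrite inE.
    have := few w; rewrite -addn1 addnC -(ler_nat R) natrD !natrM; lra.
by have := le_trans lo up; rewrite lee_fin; lra.
Qed.

(** * Entropy of streams with unit increments *)

Lemma sum_seq_count (V : nmodType) (I : finType) (t : seq I) (F : I -> V) :
  \sum_(u <- t) F u = \sum_j F j *+ count_mem j t.
Proof.
elim: t => [|u t IH]; first by rewrite big_nil big1.
rewrite big_cons IH /=; under [RHS]eq_bigr do rewrite mulrnDr.
rewrite big_split /= [X in _ = X + _](bigD1 u) //= eqxx mulr1n; congr (_ + _).
rewrite big1 ?addr0 // => j /negPf ju.
by rewrite eq_sym ju mulr0n.
Qed.

Section UnitStreams.
Context {R : realType} {n : nat}.

Definition unit_stream (t : seq 'I_n) : seq (update n) :=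
  [seq (i, 1 : int) | i <- t].

Lemma unit_stream_insertion_only m M t :
  (size t <= m)%N -> (0 < M)%N -> insertion_only m M (unit_stream t).
Proof.
move=> ht hM; rewrite /insertion_only size_map ht /= all_map.
by apply/allP => i _ /=; rewrite lez_nat.
Qed.

Lemma stream_vector_unit t j :
  stream_vector (unit_stream t) ord0 j = (count_mem j t)%:Z.
Proof.
suff gen X : foldl (@apply_update n) X (unit_stream t) ord0 j
           = X ord0 j + (count_mem j t)%:Z.
  by rewrite /stream_vector gen mxE add0r.
elim: t X => [|i t IH] X /=; first by rewrite addr0.
by rewrite IH /apply_update !mxE /= mul1r PoszD addrA eq_sym; case: (i == j).
Qed.

Lemma F1_unit t : F1 R (stream_vector (unit_stream t)) = (size t)%:R.
Proof.
rewrite /F1 -[in RHS]sum1_size natr_sum [RHS]sum_seq_count.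
by apply: eq_bigr => i _; rewrite stream_vector_unit.
Qed.

Lemma stream_vector_unit_neq0 t : t != [::] -> stream_vector (unit_stream t) != 0.
Proof.
case: t => // i t _; apply/eqP => /rowP/(_ i)/eqP.
by rewrite stream_vector_unit mxE /= eqxx.
Qed.

(** Coordinate j has weight proportional to its multiplicity, so the entropy is an average over
    stream items; absent symbols drop out and ln 0 never arises. *)
Lemma entropy_unit t : entropy R (stream_vector (unit_stream t)) =
  - ((size t)%:R^-1 * \sum_(u <- t) log2 ((count_mem u t)%:R / (size t)%:R)).
Proof.
rewrite /entropy F1_unit [X in _ = - (_ * X)]sum_seq_count mulr_sumr; congr (- _).
apply: eq_bigr => j _ /=.
rewrite stream_vector_unit mulrnAr -[RHS]mulr_natl mulrA.
by rewrite [`|_|%:~R](_ : _ = (count_mem j t)%:R).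
Qed.

End UnitStreams.

(** * Encoding a pair of sets as a stream *)

Section Encoding.
Context {R : realType} {n : nat} {T : finType}.
Context (e : T * bool -> 'I_n) (e_inj : injective e).

(** Each index is sent once with its membership bit, so the length does not depend on the set. For
    injective [e], two sets hit one symbol twice where they agree and two symbols once each where
    they differ. *)
Definition codes (x : {set T}) : seq 'I_n := [seq e (i, i \in x) | i <- enum T].

Lemma size_codes x : size (codes x) = #|T|.
Proof. by rewrite size_map -cardE. Qed.

Lemma count_codes x i b : count_mem (e (i, b)) (codes x) = ((i \in x) == b).
Proof.
rewrite count_map (@eq_count _ _ (fun j => (j == i) && ((i \in x) == b))).
  case: eqP => _; last first.
    by rewrite (eq_count (a2 := pred0)) ?count_pred0 // => j; rewrite andbF.
  rewrite (eq_count (a2 := pred1 i)) => [|j]; last by rewrite andbT.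
  by rewrite count_uniq_mem ?enum_uniq // mem_enum.
by move=> j /=; rewrite (inj_eq e_inj) xpair_eqE; case: eqP => // ->.
Qed.

(** Among 2N items, one at an index of agreement has frequency 1/N and contributes log N; one at an
    index of disagreement has frequency 1/(2N) and contributes log N + 1. *)
Lemma entropy_codes (x y : {set T}) : (0 < #|T|)%N ->
  entropy R (stream_vector (unit_stream (codes x ++ codes y)))
  = log2 #|T|%:R + #|symdiff x y|%:R / #|T|%:R.
Proof.
move=> T0; rewrite entropy_unit size_cat !size_codes addnn -mul2n natrM.
set N : R := #|T|%:R.
have N0 : 0 < N by rewrite ltr0n.
have ln20 : 0 < ln 2 :> R by rewrite ln_gt0 // ltr1n.
(* The contribution of one player's items; the other player's follows by symmetry. *)
have half (a b : {set T}) : \sum_(u <- codes a)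
    log2 ((count_mem u (codes a ++ codes b))%:R / (2 * N))
  = - (N * log2 N) - #|symdiff a b|%:R.
  rewrite big_map big_enum /=.
  under eq_bigr do rewrite count_cat !count_codes eqxx.
  rewrite (eq_bigr (fun i => - log2 N - ((i \in symdiff a b) : nat)%:R)); last first.
    move=> i _; rewrite inE /log2.
    have lnN2 : ln (2 * N)^-1 = - ln 2 - ln N :> R.
      by rewrite lnV ?posrE ?mulr_gt0 // lnM ?posrE // opprD.
    case: (i \in a); case: (i \in b) => /=.
    - by rewrite invfM mulrA divff // mul1r lnV ?posrE //; field; lra.
    - by rewrite mul1r lnN2; field; lra.
    - by rewrite mul1r lnN2; field; lra.
    - by rewrite invfM mulrA divff // mul1r lnV ?posrE //; field; lra.
  rewrite big_split /= sumr_const sumrN -natr_sum; congr (_ - _%:R).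
    by rewrite -mulr_natr mulNr mulrC.
  by rewrite sum_bool_card; apply: eq_card => i; rewrite unfold_in.
rewrite big_cat /= half.
under eq_bigr do rewrite count_cat addnC -count_cat.
rewrite half (_ : symdiff y x = symdiff x y); last first.
  by apply/setP => i; rewrite !inE addbC.
by field; lra.
Qed.

End Encoding.

(** * From an estimator to a memory bound *)

Lemma run_cat (n s : nat) (step : nat -> memory s -> update n -> memory s)
    (t : nat) (x : memory s) (st st' : seq (update n)) :
  run step t x (st ++ st') = run step (t + size st)%N (run step t x st) st'.
Proof.
elim: st t x => [|u st IH] t x /=; first by rewrite addn0.
by rewrite IH addSnnS.
Qed.

Lemma measurable_good (R : realType) (n s : nat) (A : streaming_algorithm R n s)
    (st : seq (update n)) (h eps : R) :
  measurable [set w | `|output A st w - h| < eps]%classic.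
Proof.
have m : measurable_fun setT (output A st : seed A -> R) := @measurable_report _ _ _ A st.
have := @measurable_fun_ltr _ _ R setT (fun w => `|output A st w - h|) (cst eps).
move=> /(_ _ _)/= H.
rewrite -[X in measurable X]setTI; apply: H => //.
  by apply: measurableT_comp => //; apply: measurable_funB.
Qed.

(** The averaging half of Yao's principle: under the uniform distribution on a finite family of
    inputs, some fixed seed does as well as the random one. *)
Lemma good_seed (R : realType) (n s : nat) (A : streaming_algorithm R n s)
    (m M : nat) (eps : R) (I : finType) (t : I -> seq 'I_n) :
  (0 < M)%N -> (forall i, t i != [::] /\ (size (t i) <= m)%N) ->
  estimates_entropy A m M eps ->
  exists w, (2 * #|I| <= 3 * \sum_i (`|output A (unit_stream (t i)) w
    - entropy R (stream_vector (unit_stream (t i)))| < eps)%R)%N.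
Proof.
move=> M0 ht hA.
apply: (@exists_mostly_good _ _ _ (seed_law A)) => i.
  exact: measurable_good.
by have [t0 tm] := ht i; apply: hA;
  [exact: unit_stream_insertion_only | exact: stream_vector_unit_neq0].
Qed.

Lemma log2_4 (R : realType) : log2 (4 : R) = 2.
Proof.
have ln20 : 0 < ln 2 :> R by rewrite ln_gt0 // ltr1n.
have -> : 4 = 2 ^+ 2 :> R by ring.
by rewrite /log2 lnXn // -[ln 2 *+ 2]mulr_natl mulfK // gt_eqF.
Qed.

(* Compares the constant stream 0000 (entropy 0) with 0123 (entropy 2). *)
Lemma memory_gt0 (R : realType) (n m M s : nat) (A : streaming_algorithm R n s)
    (eps : R) : eps < 1 -> (4 <= n)%N -> (4 <= m)%N -> (0 < M)%N ->
  estimates_entropy A m M eps -> (0 < s)%N.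
Proof.
case: n A => [|[|[|[|n]]]] // A eps1 _ m4 M0 hA.
case: (posnP s) => // s0.
pose o (k : nat) (hk : (k < n.+4)%N) : 'I_n.+4 := Ordinal hk.
pose t (b : bool) : seq 'I_n.+4 :=
  if b then nseq 4 (o 0%N isT) else [:: o 0%N isT; o 1%N isT; o 2%N isT; o 3%N isT].
have ht b : t b != [::] /\ (size (t b) <= m)%N by case: b.
have [w] := @good_seed _ _ _ A _ _ _ _ _ M0 ht hA.
have Ht : entropy R (stream_vector (unit_stream (t true))) = 0.
  rewrite entropy_unit /t big_nseq (_ : count_mem _ _ = 4%N) //.
  by rewrite divff ?pnatr_eq0 // /log2 ln1 mul0r /= !addr0 mulr0 oppr0.
have Hf : entropy R (stream_vector (unit_stream (t false))) = 2.
  rewrite entropy_unit /t big_seq (eq_bigr (fun=> - 2 : R)) => [|i it].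
    by rewrite -big_seq big_const_seq count_predT /=; lra.
  rewrite count_uniq_mem // it -[- 2]/(- 2%:R) -log2_4 /log2.
  by rewrite mul1r lnV ?posrE // mulNr.
rewrite card_bool big_bool Ht Hf.
(* Both streams have length 4, so the free clock cannot separate them either. *)
have <- : output A (unit_stream (t true)) w = output A (unit_stream (t false)) w.
  by rewrite /output; subst s; congr (report _ _ _); rewrite [LHS]tuple0 [RHS]tuple0.
set z := output _ _ _; rewrite !ltr_norml => hz.
(* Being good for two thirds of two streams means being good for both. *)
have : (`|z - 0| < eps) && (`|z - 2| < eps).
  by rewrite !ltr_norml; move: hz; do 2 case: (_ && _).
rewrite !ltr_norml; lra.
Qed.

(** The universe has N = 8L elements; 16L = 2N is both the number of symbols (i, b) and the length
    of the joint stream, and 16 L eps = 2 eps N is the uncertainty in the Hamming distance. *)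
Lemma memory_exponential (R : realType) (n m M s : nat)
    (A : streaming_algorithm R n s) (eps : R) (q L : nat) :
  (0 < L)%N -> (18 * q ^ 2 <= L)%N -> 16 * L%:R * eps <= q%:R ->
  (16 * L <= n)%N -> (16 * L <= m)%N -> (0 < M)%N ->
  estimates_entropy A m M eps -> (2 ^ L <= 6 * 2 ^ s)%N.
Proof.
move=> L0 qL epsq Ln Lm M0 hA.
pose T : finType := 'I_(8 * L).
have cT : #|T| = (8 * L)%N by rewrite card_ord.
have cTb : (#|{: T * bool}| <= n)%N by rewrite card_prod card_bool cT; lia.
pose e (p : T * bool) : 'I_n := widen_ord cTb (enum_rank p).
have e_inj : injective e.
  by move=> p p' /(congr1 val) /= /ord_inj /enum_rank_inj.
pose t (p : {set T} * {set T}) := codes e p.1 ++ codes e p.2.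
have ht p : t p != [::] /\ (size (t p) <= m)%N.
  by rewrite -size_eq0 size_cat !size_codes cT; split; lia.
have [w hw] := @good_seed _ _ _ A _ _ _ _ _ M0 ht hA.
pose c (x : {set T}) : s.-tuple bool :=
  run (step w) 0 (init w) (unit_stream (codes e x)).
pose G (x y : {set T}) := `|output A (unit_stream (t (x, y))) w
    - entropy R (stream_vector (unit_stream (t (x, y))))| < eps.
have cK : #|{: s.-tuple bool}| = (2 ^ s)%N by rewrite card_tuple card_bool.
rewrite -cK; apply: (hamming_collision T _ c G L q) => //.
- move=> x x' y cxx'; rewrite /G !entropy_codes ?cT //; try lia.
  (* At the handover both the memory and the clock agree, so the rest of the run is identical. *)
  have -> : output A (unit_stream (t (x, y))) w = output A (unit_stream (t (x', y))) w.
    rewrite /output /t /unit_stream !map_cat !run_cat !size_cat !size_map.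
    congr (report _ _ (run _ _ _ _)); exact: cxx'.
  move: (output _ _ _) (log2 _) => z l; rewrite !ltr_norml => hx hx'.
  have N0 : 0 < (8 * L)%:R :> R by rewrite ltr0n; lia.
  rewrite -(ltr_nat R) natrD -ltrBlDl; apply: (lt_le_trans _ epsq).
  have -> : 16 * L%:R * eps = (8 * L)%:R * (2 * eps) by rewrite natrM; ring.
  rewrite -ltr_pdivrMl // mulrC mulrBl; lra.
- move: hw; rewrite -(pair_bigA _ (fun x y => nat_of_bool (G x y))) /= card_prod.
  by rewrite -cardsT -powersetT card_powerset cardsT cT mulnA.
Qed.

Theorem theorem31 (R : realType) :
  exists c C : R, 0 < c /\ 0 < C /\
    forall (eps : R) (n m M s : nat) (A : streaming_algorithm R n s),
      0 < eps -> eps < 1 ->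
      C * eps ^- 2 <= n%:R -> C * eps ^- 2 <= m%:R -> (0 < M)%N ->
      estimates_entropy A m M eps ->
      c * eps ^- 2 <= s%:R.
Proof.
(* With L = 18 q^2, the condition 16 L eps <= q becomes 288 q eps <= 1, so q is the integer part of
   u = 1/(288 eps) and the goal is u^2 <= s. The constant 4 ensures n, m >= 4, and covers 16 L = 288
   q^2 <= eps^-2 / 288. *)
exists (288 ^- 2), 4; split; first by rewrite invr_gt0 exprn_gt0 ?ltr0n.
split=> // eps n m M s A eps0 eps1; rewrite -[eps ^- 2]exprVn.
set v := eps^-1 => hn hm M0 hA; rewrite -exprVn -exprMn mulrC.
set u := v / 288.
have v1 : 1 < v by rewrite invf_gt1.
have v2 : 1 <= v ^+ 2 by rewrite expr_ge1 // ltW // (lt_trans ltr01).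
have ge4 k : 4 * v ^+ 2 <= k%:R -> (4 <= k)%N.
  by move=> hk; rewrite -(ler_nat R); apply: le_trans hk; lra.
have s0 : (0 < s)%N.
  by apply: (@memory_gt0 R n m M s A eps) => //; exact: ge4.
have s1 : 1 <= s%:R :> R by rewrite ler1n.
have u0 : 0 <= u by rewrite divr_ge0 ?ler0n // ltW // (lt_trans ltr01).
pose q := Num.truncn u.
have /andP[ql] : q%:R <= u < q.+1%:R by rewrite truncn_itv.
rewrite -[q.+1%:R]natr1 => qu.
(* If q = 0 then u < 1, and one bit of memory suffices for the bound. *)
have [q0|qpos] := posnP q.
  by apply: le_trans s1; rewrite expr_le1 // ltW //; move: qu; rewrite q0 add0r.
have q1 : 1 <= q%:R :> R by rewrite ler1n.
pose L := (18 * q ^ 2)%N.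
have LE : L%:R = 18 * q%:R ^+ 2 :> R by rewrite natrM natrX.
have small k : 4 * v ^+ 2 <= k%:R -> (16 * L <= k)%N.
  move=> hk; rewrite -(ler_nat R) natrM LE; apply: le_trans hk.
  have : q%:R ^+ 2 <= u ^+ 2 by rewrite ler_pXn2r ?nnegrE.
  by rewrite /u expr_div_n; lra.
have L0 : (0 < L)%N by rewrite muln_gt0 expn_gt0 qpos.
have Ls : (L <= 3 * s)%N.
  (* From 2^L <= 6 * 2^s < 2^(s+3); then L <= s + 2 <= 3s because s >= 1. *)
  suff : (L < s + 3)%N by move: (L) s0; clear; lia.
  rewrite -(@ltn_exp2l 2) // expnD.
  apply: (@leq_ltn_trans (6 * 2 ^ s)).
    apply: (@memory_exponential R n m M s A eps q L) => //; [|exact: small..].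
    have : q%:R * eps <= 288^-1 by rewrite -ler_pdivlMr // mulrC.
    rewrite LE; nra.
  by rewrite mulnC ltn_pmul2l // expn_gt0.
have LsR : 18 * q%:R ^+ 2 <= 3 * s%:R :> R by rewrite -LE -natrM ler_nat.
(* As q >= 1, u < q + 1 <= 2q, so u^2 <= 4 q^2 <= 2s/3. *)
have uq : u <= 2 * q%:R by lra.
have : u * u <= (2 * q%:R) * (2 * q%:R) by apply: ler_pM.
rewrite expr2; lra.
Qed.
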